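(* Consider an $r$-th order local crack initiation model with independent increments and linear elasticity state equation, with fixed loads $f,g$, intensity functions $\varrho_{\mathrm{vol}},\varrho_{\mathrm{sur}}:\mathscr{T}\times\mathbb{R}^d\to[0,\infty)$ and associated crack initiation times $T_\Omega$, $\Omega\in\mathcal{O}$. Let $t^*\in\mathscr{T}$. Then the optimal reliability problem ''find $\Omega^*\in\mathcal{O}$ such that $P(T_{\Omega^*}\le t^* )\le P(T_\Omega\le t^* )$ for all $\Omega\in\mathcal{O}$'' is equivalent to the shape optimization problem ''find $\Omega^*\in\mathcal{O}$ such that $J(\Omega^*,u(\Omega^* ))\le J(\Omega,u(\Omega))$ for all $\Omega\in\mathcal{O}$'', where $u(\Omega)$ is the unique solution of the elasticity equation on $\Omega$ and, for sufficiently regular $y:\Omega^{\mathrm{ext}}\to\mathbb{R}^3$, $$J(\Omega,y)=\int_\Omega\mathcal{F}_{\mathrm{vol}}(x,y,\nabla y,\dots,\nabla^ry)\,dx+\int_{\partial\Omega}\mathcal{F}_{\mathrm{sur}}(x,y,\nabla y,\dots,\nabla^ry)\,dA$$ with $\mathcal{F}_{\mathrm{vol}}(\cdot)=\int_0^{t^*}\varrho_{\mathrm{vol}}(t,\cdot)\,dt$ and $\mathcal{F}_{\mathrm{sur}}(\cdot)=\int_0^{t^*}\varrho_{\mathrm{sur}}(t,\cdot)\,dt$. In particular, in the case of $s$-regular intensity functions, $\mathcal{F}_{\mathrm{vol}},\mathcal{F}_{\mathrm{sur}}\in C^s(\mathbb{R}^d)$.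
   Context: The time axis $\mathscr{T}$ is $\mathbb{N}_0$ (with counting measure $dt$) or $[0,\infty)$ (with Lebesgue measure $dt$); $\int_0^{t^*}$ denotes integration over $\{t\in\mathscr{T}:t\le t^*\}$. $\mathcal{O}$ is a family of bounded Lipschitz domains with closures contained in a bounded set $\Omega^{\mathrm{ext}}\subset\mathbb{R}^3$. For each $\Omega\in\mathcal{O}$, with partition $\partial\Omega=\partial\Omega_D\cup\partial\Omega_N$, outward normal $\nu$, Lamé coefficients $\lambda,\mu>0$ and time-independent loads $f\in\mathscr{V}_{\mathrm{vol}}$, $g\in\mathscr{V}_{\mathrm{sur}}$ (spaces of vector fields on $\Omega^{\mathrm{ext}}$), it is assumed that there is a unique (weak) solution $u=u(\Omega)$ of $\nabla\cdot\sigma(u)+f=0$ in $\Omega$, $\sigma(u)=\lambda(\nabla\cdot u)I+\mu(\nabla u+\nabla u^T)$, $u=0$ on $\partial\Omega_D$, $\sigma(u)\nu=g$ on $\partial\Omega_N$. Local crack initiation model: let $r\in\mathbb{N}$, $d=3+\sum_{j=0}^r3^{j+1}$, and let $\varrho_{\mathrm{vol}},\varrho_{\mathrm{sur}}:\mathscr{T}\times\mathbb{R}^d\to[0,\infty)$ be measurable. It is assumed that the weak derivatives $\nabla^lu$ (arrays of all partial derivatives of order $l$), $l=0,\dots,r$, are measurable functions and that their traces on $\partial\Omega$ are well defined in the sense of measurable functions. With $\mathscr{C}^{\mathrm{ext}}=\mathscr{T}\times\Omega^{\mathrm{ext}}$, the $r$-th order local crack initiation model with independent increments and linear elasticity state equation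 assigns to $\Omega$ the Poisson point process $\gamma_\Omega$ on $\mathscr{C}^{\mathrm{ext}}$ with intensity measure $$\rho_\Omega(B)=\int_{B\cap(\mathscr{T}\times\Omega)}\varrho_{\mathrm{vol}}(t,x,u,\nabla u,\dots,\nabla^ru)\,dt\,dx+\int_{B\cap(\mathscr{T}\times\partial\Omega)}\varrho_{\mathrm{sur}}(t,x,u,\nabla u,\dots,\nabla^ru)\,dt\,dA,\quad B\subseteq\mathscr{C}^{\mathrm{ext}}\text{ Borel},$$ where it is required that $\rho_\Omega$ is a Radon measure on $\mathscr{C}^{\mathrm{ext}}$, i.e. finite on bounded Borel sets. The crack initiation time is $T_\Omega=\tau(\gamma_\Omega)$, $\tau(\gamma)=\inf\{t>0:\gamma(\mathscr{C}^{\mathrm{ext}}_t)>0\}\in\mathscr{T}\cup\{\infty\}$, $\mathscr{C}^{\mathrm{ext}}_t=\{(t',x)\in\mathscr{C}^{\mathrm{ext}}:t'\le t\}$. For $s\in\mathbb{N}_0$, the intensity functions are called $s$-regular if $\varrho_{\mathrm{vol}},\varrho_{\mathrm{sur}}\in C^0(\mathscr{T})\otimes C^s(\mathbb{R}^d)$ (continuous in $t$ with values in $C^s(\mathbb{R}^d)$, so that the time integral is a Bochner integral). *)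

(* Defs.v *)
From HB Require Import structures.
From mathcomp Require Import all_boot all_order all_algebra.
From mathcomp Require Import lra.
From mathcomp Require Import all_classical all_reals all_analysis.
From mathcomp Require Import measurable_realfun.
Set Implicit Arguments.
Unset Strict Implicit.
Unset Printing Implicit Defensive.
Import Order.TTheory GRing.Theory Num.Theory.
Import numFieldNormedType.Exports.
Local Open Scope classical_set_scope.
Local Open Scope ring_scope.

Definition borel_display : measure_display. Proof. exact. Qed.

HB.instance Definition _ (R : realType) (m n : nat) :=
  @isMeasurable.Build borel_display 'M[R]_(m, n)
    <<s @open 'M[R]_(m, n) >> (@sigma_algebra0 _ setT _) (@sigma_algebraC _ _)
    (@sigma_algebra_bigcup _ setT _).

Lemma open_measurable_mx (R : realType) m n (U : set 'M[R]_(m, n)) :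
  open U -> measurable U.
Proof. exact: sub_sigma_algebra. Qed.

Section measurable_rV.
Context {R : realType} {n : nat} d {T : measurableType d}.
Variable f : T -> 'rV[R]_n.
Hypothesis mf : forall i, measurable_fun setT (fun t => f t 0 i).

Let measurable_preimage_open (U : set 'rV[R]_n) :
  open U -> measurable (f @^-1` U).
Proof.
move=> oU.
pose I : Type := ('rV[rat]_n * 'rV[rat]_n)%type.
pose box (q : I) : set 'rV[R]_n :=
  [set x | forall i, `]ratr (q.1 0 i), ratr (q.2 0 i)[%classic (x 0 i)].
have mbox q : measurable (f @^-1` box q).
  have -> : f @^-1` box q = \bigcap_(i in [set: 'I_n])
      ((fun t => f t 0 i) @^-1` `]ratr (q.1 0 i), ratr (q.2 0 i)[%classic).
    by apply/seteqP; split => [t h i _|t h i]; [exact: h|exact: (h i)].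
  apply: fin_bigcap_measurable; first exact: finite_finset.
  by move=> i _; rewrite -[X in measurable X]setTI; exact: mf.
pose F (q : I) := [set t | (f @^-1` box q) t /\ box q `<=` U].
have -> : f @^-1` U = \bigcup_q F q.
  apply/seteqP; split => [t Ut|t [q _ [bt]]]; last exact.
  have /nbhs_ballP[e /= e0 eU] := open_nbhs_nbhs (conj oU Ut : open_nbhs (f t) U).
  have e_lo i : f t 0 i - e < f t 0 i by rewrite ltrBlDr ltrDl.
  have e_hi i : f t 0 i < f t 0 i + e by rewrite ltrDl.
  pose lo := \row_i sval (cid (rat_in_itvoo (e_lo i))).
  pose hi := \row_i sval (cid (rat_in_itvoo (e_hi i))).
  have loP i : ratr (lo 0 i) \in `]f t 0 i - e, f t 0 i[.
    by rewrite mxE; case: cid.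
  have hiP i : ratr (hi 0 i) \in `]f t 0 i, f t 0 i + e[.
    by rewrite mxE; case: cid.
  exists (lo, hi) => //; split.
    move=> i /=; rewrite in_itv/=.
    by move: (loP i) (hiP i); rewrite !in_itv/= => /andP[_ ->] /andP[->].
  move=> x bx; apply: eU; split => // i j; rewrite ord1.
  have := bx j; rewrite /ball/= in_itv/= => /andP[lx xh].
  move: (loP j) (hiP j); rewrite !in_itv/= => /andP[l1 l2] /andP[h1 h2].
  rewrite ltr_norml; apply/andP; split; lra.
apply: countable_bigcupT_measurable => [|q]; first exact: countableP.
have [bU|nbU] := pselect (box q `<=` U).
  by rewrite (_ : F q = f @^-1` box q)//; apply/seteqP; split => t // -[].
by rewrite (_ : F q = set0)//; apply/seteqP; split => t // -[].
Qed.

Lemma measurable_rV : measurable_fun setT f.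
Proof.
apply: (measurability (@open 'rV[R]_n)) => // _ [U oU <-].
by rewrite setTI; exact: measurable_preimage_open.
Qed.

End measurable_rV.

Section euclidean.
Context {R : realType} {n : nat}.
Implicit Types x y : 'rV[R]_n.

Definition dotp x y : R := \sum_i x 0 i * y 0 i.

(* The norm carried by ['rV[R]_n] is the maximum norm. *)
Definition enorm x : R := Num.sqrt (dotp x x).

Definition eball x (e : R) : set 'rV[R]_n := [set y | enorm (y - x) < e].

Definition ediam (A : set 'rV[R]_n) : \bar R :=
  maxe 0%E (ereal_sup [set (enorm (p.1 - p.2))%:E | p in A `*` A]).

Lemma ler_coord_enorm x i : `|x 0 i| <= enorm x.
Proof.
rewrite -sqrtr_sqr /enorm ler_wsqrtr// /dotp (bigD1 i)//= -expr2 lerDl.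
by apply: sumr_ge0 => j _; rewrite -expr2 sqr_ge0.
Qed.

Lemma ediam_ge0 A : (0 <= ediam A)%E.
Proof. by rewrite /ediam le_max lexx. Qed.

Lemma le_ediam A B : A `<=` B -> (ediam A <= ediam B)%E.
Proof.
move=> AB; rewrite /ediam ge_max !le_max lexx/=; apply/orP; right.
apply: ge_ereal_sup => _ [p [p1 p2] <-]; apply: ereal_sup_ubound.
by exists p => //; split; apply: AB.
Qed.

Lemma ediam0 : ediam set0 = 0%E.
Proof.
rewrite /ediam (_ : [set _ | _ in _] = set0) ?ereal_sup0 ?maxeNy//.
by apply/seteqP; split => // _ [p [[]]].
Qed.

Lemma coord_le_ediam A x y i : A x -> A y ->
  ((x 0 i - y 0 i)%:E <= ediam A)%E.
Proof.
move=> Ax Ay; rewrite /ediam le_max; apply/orP; right.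
apply: (@le_trans _ _ (enorm (x - y))%:E).
  rewrite lee_fin (le_trans (ler_norm _))//.
  by have := ler_coord_enorm (x - y) i; rewrite !mxE.
by apply: ereal_sup_ubound; exists (x, y).
Qed.

End euclidean.

Section hausdorff.
Context {R : realType} {n : nat}.
Local Open Scope ereal_scope.
Implicit Types A B : set 'rV[R]_n.

Definition hausdorff_size (delta : R) A : \bar R :=
  if ediam A <= delta%:E then (pi / 4)%:E * ediam A ^+ 2 else +oo.

(* [mu_ext] takes the infimum over countable covers by measurable sets; as a
   set and its closure have the same diameter, this does not change the value
   obtained with covers by arbitrary sets. *)
Definition hausdorff_pre (delta : R) : set 'rV[R]_n -> \bar R :=
  mu_ext (hausdorff_size delta).

(* Two-dimensional Hausdorff measure, normalised by pi / 4 so that it is the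
   surface area on the boundary of a Lipschitz domain of R^3. *)
Definition hausdorff2 A : \bar R :=
  ereal_sup [set hausdorff_pre delta A | delta in [set delta | (0 < delta)%R]].

Let pi4_ge0 : 0 <= (pi / 4 : R)%:E.
Proof. by rewrite lee_fin divr_ge0// pi_ge0. Qed.

Let size0 delta : (0 < delta)%R -> hausdorff_size delta set0 = 0.
Proof.
by move=> d0; rewrite /hausdorff_size ediam0 lee_fin ltW// expeS mul0e mule0.
Qed.

Let size_ge0 delta A : 0 <= hausdorff_size delta A.
Proof.
rewrite /hausdorff_size; case: ifP => // _.
by apply: mule_ge0 => //; apply: mule_ge0; exact: ediam_ge0.
Qed.

Let le_size delta A B : A `<=` B -> hausdorff_size delta A <= hausdorff_size delta B.
Proof.
move=> AB; rewrite /hausdorff_size; case: (leP (ediam B)) => [Bd|]; last first.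
  by rewrite leey.
rewrite (le_trans (le_ediam AB) Bd) lee_wpmul2l//.
by apply: lee_pmul => //; rewrite ?ediam_ge0//; exact: le_ediam.
Qed.

Let size_anti (delta epsilon : R) A : (delta <= epsilon)%R ->
  hausdorff_size epsilon A <= hausdorff_size delta A.
Proof.
move=> de; rewrite /hausdorff_size; case: (leP _ delta%:E); last by rewrite leey.
by move=> Ad; rewrite (le_trans Ad)// lee_fin.
Qed.

Let pre_anti (delta epsilon : R) A : (delta <= epsilon)%R ->
  hausdorff_pre epsilon A <= hausdorff_pre delta A.
Proof.
move=> de; apply: le_ereal_inf_tmp => _ [F FA <-].
apply: (@le_trans _ _ (\sum_(k <oo) hausdorff_size epsilon (F k))).
  by apply: ereal_inf_lbound; exists F.
by apply: lee_nneseries => k *; [exact: size_ge0|exact: size_anti].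
Qed.

Let pre_le delta A : (0 < delta)%R -> hausdorff_pre delta A <= hausdorff2 A.
Proof. by move=> d0; apply: ereal_sup_ubound; exists delta. Qed.

Let hausdorff20 : hausdorff2 set0 = 0.
Proof.
apply/eqP; rewrite eq_le; apply/andP; split.
  by apply: ge_ereal_sup => _ [delta d0 <-]; rewrite /hausdorff_pre mu_ext0// size0.
by apply: (le_trans _ (pre_le _ ltr01)); exact: mu_ext_ge0.
Qed.

Let hausdorff2_ge0 A : 0 <= hausdorff2 A.
Proof. by apply: (le_trans _ (pre_le _ ltr01)); exact: mu_ext_ge0. Qed.

Let le_hausdorff2 : {homo hausdorff2 : A B / A `<=` B >-> A <= B}.
Proof.
move=> A B AB; apply: ge_ereal_sup => _ [delta d0 <-].
by apply: (le_trans _ (pre_le _ d0)); exact: le_mu_ext.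
Qed.

Let hausdorff2_sigma_subadditive : sigma_subadditive hausdorff2.
Proof.
move=> F; apply: ge_ereal_sup => _ [delta d0 <-].
apply: (le_trans (mu_ext_sigma_subadditive (size_ge0 delta) F)).
by apply: lee_nneseries => k *; [exact: mu_ext_ge0|exact: pre_le].
Qed.

HB.instance Definition _ := isOuterMeasure.Build R 'rV[R]_n hausdorff2
  hausdorff20 hausdorff2_ge0 le_hausdorff2 hausdorff2_sigma_subadditive.

Let measurable_lt (i : 'I_n) (c : R) : measurable [set x : 'rV[R]_n | (x 0 i < c)%R].
Proof.
apply: open_measurable_mx.
have /continuousP := @coord_continuous R 1 n ord0 i.
by move/(_ [set y : R | (y < c)%R]); apply; exact: open_lt.
Qed.

Let pre_separated delta (i : 'I_n) (a b : R) A B : (0 < delta)%R -> (delta < b - a)%R ->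
  (forall x, A x -> (x 0 i < a)%R) -> (forall x, B x -> (b <= x 0 i)%R) ->
  hausdorff_pre delta A + hausdorff_pre delta B <= hausdorff_pre delta (A `|` B).
Proof.
move=> d0 dab Aa bB; apply: le_ereal_inf_tmp => _ [F [mF ABF] <-].
pose G k := F k `&` [set x | (x 0 i < a)%R].
pose H k := F k `\` [set x | (x 0 i < b)%R].
apply: (@le_trans _ _ (\sum_(k <oo) hausdorff_size delta (G k) +
                       \sum_(k <oo) hausdorff_size delta (H k))).
  apply: leeD; apply: ereal_inf_lbound.
    exists G => //; split=> [k|x Ax]; first exact: (measurableI _ _ (mF k) (measurable_lt i a)).
    by have [k _ Fkx] := ABF x (or_introl Ax); exists k => //; split => //; exact: Aa.
  exists H => //; split=> [k|x Bx]; first exact: (measurableD (mF k) (measurable_lt i b)).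
  have [k _ Fkx] := ABF x (or_intror Bx); exists k => //; split => //=.
  by apply/negP; rewrite -leNgt; exact: bB.
rewrite -nneseriesD//; apply: lee_nneseries => k *; first exact: adde_ge0.
have GF : G k `<=` F k by move=> x [].
have HF : H k `<=` F k by move=> x [].
have [->|/set0P[x [Fx xa]]] := eqVneq (G k) set0; first by rewrite size0// add0e le_size.
have [->|/set0P[y [Fy /negP]]] := eqVneq (H k) set0; first by rewrite size0// adde0 le_size.
rewrite -leNgt => yb; rewrite {3}/hausdorff_size ifF ?leey//.
apply/negP => Fd; have := le_trans (coord_le_ediam i Fy Fx) Fd.
rewrite lee_fin; move: xa => /= xa; lra.
Qed.

Let hausdorff2_separated (i : 'I_n) (a b : R) A B : (a < b)%R ->
  (forall x, A x -> (x 0 i < a)%R) -> (forall x, B x -> (b <= x 0 i)%R) ->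
  hausdorff2 A + hausdorff2 B <= hausdorff2 (A `|` B).
Proof.
move=> ab Aa bB.
have key d1 d2 : (0 < d1)%R -> (0 < d2)%R ->
    hausdorff_pre d1 A + hausdorff_pre d2 B <= hausdorff2 (A `|` B).
  move=> d10 d20; pose d := Num.min (Num.min d1 d2) ((b - a) / 2)%R.
  have d0 : (0 < d)%R by rewrite !lt_min d10 d20 divr_gt0// subr_gt0.
  have dd1 : (d <= d1)%R by rewrite !ge_min lexx.
  have dd2 : (d <= d2)%R by rewrite !ge_min lexx orbT.
  have dab : (d <= (b - a) / 2)%R by rewrite !ge_min lexx !orbT.
  apply: (le_trans _ (pre_le _ d0)).
  apply: (le_trans (leeD (pre_anti _ dd1) (pre_anti _ dd2))).
  by apply: (@pre_separated d i a b) => //; lra.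
have [->|fM] := eqVneq (hausdorff2 (A `|` B)) +oo; first by rewrite leey.
have fin C : C `<=` A `|` B -> hausdorff2 C \is a fin_num.
  move=> CAB; rewrite ge0_fin_numE ?outer_measure_ge0//.
  by rewrite (le_lt_trans (le_outer_measure _ _ _ CAB))// ltey.
have fA := fin A (@subsetUl _ A B); have fB := fin B (@subsetUr _ A B).
rewrite -leeBrDr//; apply: ge_ereal_sup => _ [d1 d10 <-].
rewrite leeBrDr// addeC.
have fp : hausdorff_pre d1 A \is a fin_num.
  rewrite ge0_fin_numE ?mu_ext_ge0//; apply: (le_lt_trans (pre_le A d10)).
  by rewrite -ge0_fin_numE ?hausdorff2_ge0.
rewrite -leeBrDr//; apply: ge_ereal_sup => _ [d2 d20 <-].
by rewrite leeBrDr// addeC key.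
Qed.

Let cara_lt (i : 'I_n) (c : R) :
  hausdorff2.-caratheodory [set x : 'rV[R]_n | (x 0 i < c)%R].
Proof.
set A := [set x | _]; apply: le_caratheodory_measurable => X.
pose r k : R := (c - k.+1%:R^-1)%R.
have r_lt k l : (k < l)%N -> (r k < r l)%R.
  by move=> kl; rewrite ltrD2l ltrN2 ltf_pV2 ?posrE// ltr_nat.
have r_le k l : (k <= l)%N -> (r k <= r l)%R.
  by rewrite leq_eqVlt => /predU1P[->//|/r_lt/ltW].
have rc k : (r k < c)%R by rewrite ltrBlDr ltrDl.
pose D k := X `&` [set x : 'rV[R]_n | (r k <= x 0 i < r k.+1)%R].
have half j N : \sum_(k < N.+1) hausdorff2 (D (k.*2 + j)%N) <=
    hausdorff2 (X `&` [set x : 'rV[R]_n | (x 0 i < r (N.*2 + j).+1)%R]).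
  elim: N => [|N IH].
    by rewrite big_ord1; apply: le_outer_measure => x [Xx /andP[_]].
  rewrite big_ord_recr/=; apply: (le_trans (leeD2r _ IH)).
  apply: (le_trans (@hausdorff2_separated i (r (N.*2 + j).+1)
    (r (N.+1.*2 + j)%N) _ _ _ _ _)).
  - by apply: r_lt; rewrite doubleS.
  - by move=> x [].
  - by move=> x [_ /andP[]].
  apply: le_outer_measure => x [[Xx xr]|[Xx /andP[_ xr]]]; split => //=.
  by apply: (lt_le_trans xr); apply: r_le; rewrite doubleS !addSn !ltnS ltnW.
have [Xoo|Xoo] := eqVneq (hausdorff2 X) +oo.
  by rewrite [leRHS](Xoo : _ = +oo) leey.
have muXoo : hausdorff2 X < +oo by rewrite ltey.
have sumD : \sum_(0 <= k <oo) hausdorff2 (D k) < +oo.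
  apply: (@le_lt_trans _ _ (hausdorff2 X + hausdorff2 X)); last exact: lte_add_pinfty.
  apply: lime_le; first by apply: is_cvg_nneseries => k *; exact: outer_measure_ge0.
  apply: nearW => N.
  apply: (@le_trans _ _ (\sum_(0 <= k < N.+1.*2) hausdorff2 (D k))).
    rewrite [leRHS](@big_cat_nat _ _ _ N)//=; last first.
      by rewrite -addnn (leq_trans (leqnSn N)) ?leq_addr.
    by rewrite leeDl// sume_ge0// => k _; exact: outer_measure_ge0.
  have -> : \sum_(0 <= k < N.+1.*2) hausdorff2 (D k) =
      \sum_(k < N.+1) hausdorff2 (D (k.*2 + 0)%N) +
      \sum_(k < N.+1) hausdorff2 (D (k.*2 + 1)%N).
    rewrite -big_split/=; elim: (N.+1) => [|M IH]; first by rewrite big_ord0 big_nil.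
    by rewrite doubleS !big_nat_recr//= IH big_ord_recr/= -addeA addn0 addn1.
  by apply: leeD; apply: (le_trans (half _ _)); apply: le_outer_measure => x [].
have tail : \sum_(N <= k <oo) hausdorff2 (D k) @[N --> \oo] --> 0.
  by apply: nneseries_tail_cvg => // k _; exact: outer_measure_ge0.
apply/lee_addgt0Pr => e e0.
have [N _ /(_ N (leqnn N)) /= tailN] :
    \forall N \near \oo, \sum_(N <= k <oo) hausdorff2 (D k) < e%:E.
  by apply: (tail [set y | y < e%:E]); apply: open_ereal_lt'; rewrite lte_fin.
have XA : hausdorff2 (X `&` A) <=
    hausdorff2 (X `&` [set x : 'rV[R]_n | (x 0 i < r N)%R]) + e%:E.
  apply: (@le_trans _ _ (hausdorff2 ((X `&` [set x : 'rV[R]_n | (x 0 i < r N)%R]) `|`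
      \bigcup_(k in ~` `I_N) D k))); last first.
    apply: (le_trans (outer_measureU2 _ _ _)); apply: leeD => //.
    by apply: (le_trans (outer_measure_sigma_subadditive_tail _ _ _)); exact: ltW.
  apply: le_outer_measure => x [Xx xc].
  have [xN|Nx] := ltP (x 0%R i) (r N); [by left|right].
  have ex : exists m, (x 0%R i < r m)%R.
    by have [m mc] := ltr_add_invr xc; exists m; rewrite ltrBrDr.
  have [m xm mmin] := ex_minnP ex.
  have Nm : (N < m)%N.
    by rewrite ltnNge; apply/negP => /r_le mN; move: (lt_le_trans xm mN); rewrite ltNge Nx.
  case: m Nm xm mmin => // m Nm xm mmin.
  exists m; first by rewrite /= ltnNge -ltnS in Nm *; apply/negP.
  split => //=; rewrite xm andbT leNgt; apply/negP => /mmin.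
  by rewrite ltnn.
apply: (le_trans (leeD2r _ XA)); rewrite addeAC leeD2r//.
apply: (le_trans (@hausdorff2_separated i (r N) c _ _ (rc N) _ _)).
- by move=> x [].
- by move=> x [_ /negP]; rewrite -leNgt.
- by apply: le_outer_measure => x [] [].
Qed.

Let measurable_caratheodory (B : set 'rV[R]_n) :
  measurable B -> hausdorff2.-caratheodory B.
Proof.
move=> mB.
pose T := caratheodory_type hausdorff2.
have : measurable_fun [set: T] (id : T -> 'rV[R]_n).
  apply: measurable_rV => i.
  apply: (measurability _ (RGenInftyO.measurableE R)) => _ [_ [c ->] <-].
  rewrite setTI (_ : _ @^-1` _ = [set x : 'rV[R]_n | (x ord0 i < c)%R]).
    exact: cara_lt.
  by apply/seteqP; split => x /=; rewrite in_itv.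
by move=> /(_ measurableT B mB); rewrite setTI.
Qed.

Let hausdorff2_sigma_additive : semi_sigma_additive hausdorff2.
Proof.
move=> F mF tF _; apply: caratheodory_measure_sigma_additive => //.
  by move=> k; exact: measurable_caratheodory.
by apply: bigcupT_measurable => k; exact: measurable_caratheodory.
Qed.

HB.instance Definition _ := isMeasure.Build borel_display 'rV[R]_n R hausdorff2
  hausdorff20 hausdorff2_ge0 hausdorff2_sigma_additive.

End hausdorff.

Section lebesgue3.
Context {R : realType}.

Definition point3 (p : measurableTypeR R * measurableTypeR R * measurableTypeR R)
  : 'rV[R]_3 := \row_(i < 3) [:: p.1.1; p.1.2; p.2]`_i.

Definition lebesgue3 : set 'rV[R]_3 -> \bar R :=
  pushforward ((lebesgue_measure \x lebesgue_measure) \x lebesgue_measure)%E point3.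

Let measurable_point3 : measurable_fun setT point3.
Proof.
apply: measurable_rV => -[[|[|[|//]]] ?].
- apply: (eq_measurable_fun (fun p => p.1.1)) => [p _|]; first by rewrite mxE.
  exact: measurableT_comp measurable_fst measurable_fst.
- apply: (eq_measurable_fun (fun p => p.1.2)) => [p _|]; first by rewrite mxE.
  exact: measurableT_comp measurable_snd measurable_fst.
- apply: (eq_measurable_fun (fun p => p.2)) => [p _|]; first by rewrite mxE.
  exact: measurable_snd.
Qed.

Let lebesgue30 : lebesgue3 set0 = 0%E.
Proof. by rewrite /lebesgue3 /pushforward preimage_set0 measure0. Qed.

Let lebesgue3_ge0 A : (0 <= lebesgue3 A)%E.
Proof. exact: measure_ge0. Qed.

Let lebesgue3_sigma_additive : semi_sigma_additive lebesgue3.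
Proof.
move=> F mF tF mUF; rewrite /lebesgue3 /pushforward preimage_bigcup.
apply: measure_semi_sigma_additive.
- by move=> k; rewrite -[X in measurable X]setTI; exact: measurable_point3.
- apply/trivIsetP => i j _ _ ij; rewrite -preimage_setI.
  by move/trivIsetP : tF => /(_ _ _ _ _ ij) ->//; rewrite preimage_set0.
- by rewrite -preimage_bigcup -[X in measurable X]setTI; exact: measurable_point3.
Qed.

HB.instance Definition _ := isMeasure.Build borel_display 'rV[R]_3 R lebesgue3
  lebesgue30 lebesgue3_ge0 lebesgue3_sigma_additive.

End lebesgue3.

Variant time_axis := DiscreteTime | ContinuousTime.

Section time.
Context {R : realType}.
Variable k : time_axis.

Definition time_set : set R :=
  if k is DiscreteTime then range (fun n : nat => n%:R) else [set t | 0 <= t].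

(* Counting measure on the natural numbers, or Lebesgue measure on
   [0, +oo[, both seen as measures on R concentrated on [time_set]. *)
Definition time_measure (A : set R) : \bar R :=
  if k is DiscreteTime then @counting nat R [set n | A n%:R]
  else lebesgue_measure (A `&` [set t | 0 <= t]).

Let time_measure0 : time_measure set0 = 0%E.
Proof.
rewrite /time_measure; case: k; last by rewrite set0I measure0.
by rewrite (_ : [set n | _] = set0) ?measure0//; apply/seteqP; split.
Qed.

Let time_measure_ge0 A : (0 <= time_measure A)%E.
Proof. by rewrite /time_measure; case: k; exact: measure_ge0. Qed.

Let measurable_ge0 : measurable [set t : R | 0 <= t].
Proof.
rewrite (_ : [set _ | _] = `[0, +oo[%classic); first exact: measurable_itv.
by apply/seteqP; split => t /=; rewrite in_itv/= andbT.
Qed.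

Let time_measure_sigma_additive : semi_sigma_additive time_measure.
Proof.
rewrite /time_measure; case: k => F mF tF mUF.
  rewrite (_ : [set n | _] = \bigcup_i [set n | F i n%:R]); last first.
    by apply/seteqP; split.
  apply: (@measure_semi_sigma_additive _ nat _ counting
    (fun i => [set n | F i n%:R])) => //.
  apply/trivIsetP => i j _ _ ij; apply/seteqP; split => // n Fn.
  by move/trivIsetP : tF => /(_ i j Logic.I Logic.I ij) /seteqP[/(_ n%:R Fn)].
rewrite setI_bigcupl; apply: (@measure_semi_sigma_additive _ _ _
  (@lebesgue_measure R) (fun i => F i `&` [set t | 0 <= t])).
- by move=> i; exact: (measurableI _ _ (mF i) measurable_ge0).
- exact: trivIset_setIr.
- by rewrite -setI_bigcupl; exact: (measurableI _ _ mUF measurable_ge0).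
Qed.

HB.instance Definition _ := isMeasure.Build default_measure_display R R
  time_measure time_measure0 time_measure_ge0 time_measure_sigma_additive.

Let time_measure_sigma_finite : sigma_finite setT time_measure.
Proof.
exists (fun n : nat => `[- n%:R, n%:R]%classic : set R).
  apply/seteqP; split => [t _|//].
  have [n tn] : exists n : nat, `|t| <= n%:R.
    by exists (Num.bound `|t|); rewrite ltW// archi_boundP.
  by exists n => //=; rewrite in_itv/= -ler_norml.
move=> n; split; first exact: measurable_itv.
rewrite /time_measure; case: k.
  rewrite /counting asboolT ?ltry//.
  apply: (sub_finite_set _ (finite_II n.+1)) => m /=.
  by rewrite in_itv/= ler_nat ltnS => /andP[].
apply: (@le_lt_trans _ _ (lebesgue_measure (`[- n%:R, n%:R]%classic : set R))).
  apply: le_measure; rewrite ?inE; last by move=> t [].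
    exact: (measurableI _ _ (measurable_itv _) measurable_ge0).
  exact: measurable_itv.
rewrite lebesgue_measure_itv/=; case: ifP => // _; exact: ltry.
Qed.

HB.instance Definition _ := @Measure_isSigmaFinite.Build default_measure_display
  R R time_measure time_measure_sigma_finite.

End time.

Section sobolev.
Context {R : realType}.
Implicit Types (Omega : set 'rV[R]_3) (w h : 'rV[R]_3 -> R).

Definition bd Omega : set 'rV[R]_3 := closure Omega `\` Omega^°.

Definition lipschitz_domain Omega : Prop :=
  [/\ open Omega, connected Omega, Omega !=set0, bounded_set Omega &
    forall x, bd Omega x ->
      exists (e : R) (Q : 'M[R]_3) (psi : 'rV[R]_2 -> R),
        [/\ 0 < e, Q *m Q^T = 1%:M, lipschitz psi &
          forall y, eball x e y ->
            let z : 'rV[R]_(2 + 1) := y *m Q in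
            Omega y <-> psi (lsubmx z) < rsubmx z 0 0]].

(* Iterated partial derivative; [alpha] lists the directions, so that
   [size alpha] is the order of differentiation. *)
Fixpoint pderiv n (alpha : seq 'I_n) (F : 'rV[R]_n -> R) : 'rV[R]_n -> R :=
  if alpha is i :: beta then fun x => 'D_(delta_mx 0 i) (pderiv beta F) x else F.

Definition is_Cs n (s : nat) (F : 'rV[R]_n -> R) : Prop :=
  forall alpha : seq 'I_n, (size alpha <= s)%N ->
    continuous (pderiv alpha F) /\
    ((size alpha < s)%N ->
      forall i x, derivable (pderiv alpha F) x (delta_mx 0 i)).

Definition test_function Omega (phi : 'rV[R]_3 -> R) : Prop :=
  [/\ forall s, is_Cs s phi, compact (closure [set x | phi x != 0]) &
    closure [set x | phi x != 0] `<=` Omega].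

Definition locally_integrable3 Omega w : Prop :=
  measurable_fun Omega w /\
  forall K, compact K -> K `<=` Omega -> lebesgue3.-integrable K (EFin \o w).

Definition is_weak_deriv Omega w (alpha : seq 'I_3) h : Prop :=
  [/\ locally_integrable3 Omega w, locally_integrable3 Omega h &
    forall phi, test_function Omega phi ->
      \int[lebesgue3]_(x in Omega) (w x * pderiv alpha phi x) =
      (-1) ^+ size alpha * \int[lebesgue3]_(x in Omega) (h x * phi x)].

(* A representative of the weak derivative; it is unique up to null sets. *)
Definition weak_deriv Omega w (alpha : seq 'I_3) : 'rV[R]_3 -> R :=
  if alpha is [::] then w else xget (cst 0) [set h | is_weak_deriv Omega w alpha h].

(* [w0] is the trace of [w] on the boundary when, at almost every boundary
   point [x], [w] tends to [w0 x] in the sense of Lebesgue points. This agrees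
   with the restriction of [w] if [w] is continuous on the closure, and with
   the usual trace if [w] is a Sobolev function. *)
Definition is_trace Omega w (w0 : 'rV[R]_3 -> R) : Prop :=
  measurable_fun (bd Omega) w0 /\
  {ae hausdorff2, forall x, bd Omega x ->
    ((fine (lebesgue3 (Omega `&` eball x e)))^-1%:E *
      \int[lebesgue3]_(y in Omega `&` eball x e) `|w y - w0 x|%:E)%E
    @[e --> 0^'+] --> 0%E}.

Definition trace Omega w : 'rV[R]_3 -> R :=
  xget (cst 0) [set w0 | is_trace Omega w w0].

Definition square_integrable Omega w : Prop :=
  measurable_fun Omega w /\
  (\int[lebesgue3]_(x in Omega) (w x ^+ 2)%:E < +oo)%E.

Definition vcomp (v : 'rV[R]_3 -> 'rV[R]_3) (i : 'I_3) : 'rV[R]_3 -> R :=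
  fun x => v x 0 i.

(* The fields of H^1(Omega; R^3) whose trace vanishes on [D]. *)
Definition H1D Omega (D : set 'rV[R]_3) (v : 'rV[R]_3 -> 'rV[R]_3) : Prop :=
  forall i : 'I_3,
  [/\ square_integrable Omega (vcomp v i),
    forall j, exists h,
      is_weak_deriv Omega (vcomp v i) [:: j] h /\ square_integrable Omega h &
    exists w0, is_trace Omega (vcomp v i) w0 /\
      {ae hausdorff2, forall x, D x -> w0 x = 0}].

Definition weak_grad Omega (v : 'rV[R]_3 -> 'rV[R]_3) (x : 'rV[R]_3) : 'M[R]_3 :=
  \matrix_(i, j) weak_deriv Omega (vcomp v i) [:: j] x.

Definition vtrace Omega (v : 'rV[R]_3 -> 'rV[R]_3) (x : 'rV[R]_3) : 'rV[R]_3 :=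
  \row_i trace Omega (vcomp v i) x.

End sobolev.

Section elasticity.
Context {R : realType}.
Variables (lambda mu : R).
Implicit Types (Omega D N : set 'rV[R]_3) (f g u v : 'rV[R]_3 -> 'rV[R]_3).

Definition boundary_partition Omega D N : Prop :=
  [/\ measurable D, measurable N, D `|` N = bd Omega & D `&` N = set0].

Definition stress (G : 'M[R]_3) : 'M[R]_3 :=
  (lambda * \tr G)%:M + mu *: (G + G^T).

Definition is_weak_solution Omega D N f g u : Prop :=
  H1D Omega D u /\
  forall v, H1D Omega D v ->
    [/\ lebesgue3.-integrable Omega (fun x => (dotp (f x) (v x))%:E),
      hausdorff2.-integrable N (fun x => (dotp (g x) (vtrace Omega v x))%:E) &
      \int[lebesgue3]_(x in Omega)
        (\sum_i \sum_j stress (weak_grad Omega u x) i j * weak_grad Omega v x i j) =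
      \int[lebesgue3]_(x in Omega) dotp (f x) (v x) +
      \int[hausdorff2]_(x in N) dotp (g x) (vtrace Omega v x)].

Definition unique_weak_solution Omega D N f g : Prop :=
  exists u, is_weak_solution Omega D N f g u /\
    forall u', is_weak_solution Omega D N f g u' ->
      {ae lebesgue3, forall x, Omega x -> u' x = u x}.

Definition displacement Omega D N f g : 'rV[R]_3 -> 'rV[R]_3 :=
  xget (cst 0) [set u | is_weak_solution Omega D N f g u].

End elasticity.

Definition jet_dim (r : nat) : nat := (3 + \sum_(j < r.+1) 3 ^ j.+1)%N.

Section jets.
Context {R : realType}.
Variable r : nat.
Implicit Types (Omega : set 'rV[R]_3) (y : 'rV[R]_3 -> 'rV[R]_3).

Definition digit (k m : nat) : 'I_3 := inord (k %/ 3 ^ m %% 3).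

(* The point (x, D^0, ..., D^r) of R^d, where the array D^j of order j has
   entries [D alpha i], with [i] the component and [alpha] the j directions.
   They are numbered by k < 3 ^ j.+1, whose base 3 digits are [i] followed by
   [alpha]. *)
Definition jet (D : seq 'I_3 -> 'I_3 -> R) (x : 'rV[R]_3) : 'rV[R]_(jet_dim r) :=
  row_mx x (\mxrow_(j < r.+1) \row_(k < 3 ^ j.+1)
    D [seq digit k m | m <- iota 1 j] (digit k 0)).

Definition vol_jet Omega y (x : 'rV[R]_3) : 'rV[R]_(jet_dim r) :=
  jet (fun alpha i => weak_deriv Omega (vcomp y i) alpha x) x.

Definition sur_jet Omega y (x : 'rV[R]_3) : 'rV[R]_(jet_dim r) :=
  jet (fun alpha i => trace Omega (weak_deriv Omega (vcomp y i) alpha) x) x.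

Definition regular_displacement Omega y : Prop :=
  forall (alpha : seq 'I_3) (i : 'I_3), (size alpha <= r)%N ->
    (exists h, is_weak_deriv Omega (vcomp y i) alpha h) /\
    exists w0, is_trace Omega (weak_deriv Omega (vcomp y i) alpha) w0.

Definition shape_cost (Fvol Fsur : 'rV[R]_(jet_dim r) -> \bar R) Omega y : \bar R :=
  (\int[lebesgue3]_(x in Omega) Fvol (vol_jet Omega y x) +
   \int[hausdorff2]_(x in bd Omega) Fsur (sur_jet Omega y x))%E.

End jets.

Section intensities.
Context {R : realType}.
Variable k : time_axis.

Definition intensity_function d (rho : R -> 'rV[R]_d -> R) : Prop :=
  measurable_fun (time_set k `*` setT) (fun z : R * 'rV[R]_d => rho z.1 z.2) /\
  forall t x, time_set k t -> 0 <= rho t x.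

(* C^0(T; C^s(R^d)), where C^s(R^d) carries the topology of locally uniform
   convergence of the derivatives up to order [s]. *)
Definition s_regular d (s : nat) (rho : R -> 'rV[R]_d -> R) : Prop :=
  (forall t, time_set k t -> is_Cs s (rho t)) /\
  forall alpha : seq 'I_d, (size alpha <= s)%N ->
    {within time_set k, continuous
      (fun t => pderiv alpha (rho t) : {family compact, 'rV[R]_d -> R})}.

Definition time_integral d (tstar : R) (rho : R -> 'rV[R]_d -> R) (z : 'rV[R]_d)
  : \bar R :=
  (\int[time_measure k]_(t in time_set k `&` [set t | (t <= tstar)%R]) (rho t z)%:E)%E.

Definition crack_intensity r (rho_vol rho_sur : R -> 'rV[R]_(jet_dim r) -> R)
    (Omega : set 'rV[R]_3) (y : 'rV[R]_3 -> 'rV[R]_3) (B : set (R * 'rV[R]_3))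
  : \bar R :=
  (\int[time_measure k \x^ lebesgue3]_(z in B `&` (time_set k `*` Omega))
     (rho_vol z.1 (vol_jet r Omega y z.2))%:E +
   \int[time_measure k \x^ hausdorff2]_(z in B `&` (time_set k `*` bd Omega))
     (rho_sur z.1 (sur_jet r Omega y z.2))%:E)%E.

End intensities.

Section point_process.
Context {R : realType}.
Variables (k : time_axis) (Oext : set 'rV[R]_3).

Definition cracks : set (R * 'rV[R]_3) := time_set k `*` Oext.

(* [Oext] need not be Borel: the sets of this sigma-algebra that are contained
   in [cracks] are the Borel sets of the subspace [cracks]. *)
Definition crack_space : Type :=
  g_sigma_algebraType ((measurable : set (set (R * 'rV[R]_3))) `|` [set cracks]).

HB.instance Definition _ := Measurable.on crack_space.

Definition bounded_borel (B : set (R * 'rV[R]_3)) : Prop :=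
  [/\ measurable (B : set crack_space), B `<=` cracks & bounded_set B].

Definition is_radon (rho : set (R * 'rV[R]_3) -> \bar R) : Prop :=
  forall B, bounded_borel B -> (rho B < +oo)%E.

Definition cracks_until (t : R) : set (R * 'rV[R]_3) :=
  [set z | cracks z /\ z.1 <= t].

(* The infimum ranges over real [t], also for discrete time; thus a crack at
   time 0 gives the value 0. It is [+oo] if there is no crack. *)
Definition tau (N : set (R * 'rV[R]_3) -> \bar R) : \bar R :=
  ereal_inf [set t%:E | t in [set t | 0 < t /\ (0 < N (cracks_until t))%E]].

Context d {X : measurableType d} (P : probability X R).

(* Measures on [cracks] are represented by measures on [crack_space] of which
   only the values on subsets of [cracks] are considered. *)
Definition poisson_process (rho : set (R * 'rV[R]_3) -> \bar R)
    (N : X -> {measure set crack_space -> \bar R}) : Prop :=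
  [/\ forall B, measurable (B : set crack_space) -> B `<=` cracks ->
         measurable_fun setT (fun w => N w B),
      forall w B, bounded_borel B -> exists n : nat, N w B = n%:R%:E,
      forall B (n : nat), bounded_borel B ->
        P [set w | N w B = n%:R%:E] =
        (expR (- fine (rho B)) * fine (rho B) ^+ n / n`!%:R)%:E &
      forall (m : nat) (B : 'I_m -> set (R * 'rV[R]_3)) (n : 'I_m -> nat),
        (forall i, bounded_borel (B i)) -> trivIset setT B ->
        P (\bigcap_(i in [set: 'I_m]) [set w | N w (B i) = (n i)%:R%:E]) =
        (\prod_(i < m) P [set w | N w (B i) = (n i)%:R%:E])%E].

End point_process.

(* Main.v *)
Require Import Defs.
From HB Require Import structures.
From mathcomp Require Import all_boot all_order all_algebra.
From mathcomp Require Import all_classical all_reals all_analysis.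
From mathcomp Require Import measurable_realfun lra.
Set Implicit Arguments.
Unset Strict Implicit.
Unset Printing Implicit Defensive.
Import Order.TTheory GRing.Theory Num.Theory.
Import numFieldNormedType.Exports.
Local Open Scope classical_set_scope.
Local Open Scope ring_scope.

(** A Poisson process with intensity rho is empty on a bounded Borel set [B]
    with probability exp(- rho(B)). As crack configurations have
    finitely many points in bounded sets, the first crack occurs by time [t]
    exactly when there is a crack in the space-time cylinder of cracks up to
    [t] ([tau_leP]); hence P(T <= t) = 1 - exp(- rho(cylinder))
    ([prob_crack_until]). Integrating the intensity first in time and then in
    space, by Tonelli, turns rho(cylinder) into the shape functional [J]
    ([crack_intensity_until]). As x |-> 1 - exp(- x) is strictly increasing and
    [J] is finite on the shapes considered, minimising the failure probability
    and minimising [J] are the same problem.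

    Tonelli's theorem is needed here for a product with the Hausdorff measure,
    which is not sigma-finite on R^3; it still holds for the product measure
    obtained by integrating the time sections, since only the time measure has
    to be sigma-finite ([ge0_integral_product2]). The integrands are measurable
    because the weak derivatives and their traces are ([measurable_jet]).

    For the regularity of the time integrals, the times up to [t] form a compact
    set. A family of functions that depends continuously on a compact parameter,
    for locally uniform convergence, is equicontinuous at each point uniformly in
    the parameter ([compactly_equicontinuous]). This allows passing to the limit
    under the integral; together with the mean value theorem it allows
    differentiating under the integral ([is_derive_Rintegral]), and induction on
    the order of differentiation concludes ([is_Cs_Rintegral]). *)

(** * Tonelli's theorem for one sigma-finite factor *)

Section tonelli.
Local Open Scope ereal_scope.
Context d1 d2 (T1 : measurableType d1) (T2 : measurableType d2) (R : realType).
Variable m1 : {sigma_finite_measure set T1 -> \bar R}.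
Variable m2 : {measure set T2 -> \bar R}.

Import HBNNSimple.

Lemma integral_product2_indic (A : set (T1 * T2)) : measurable A ->
  \int[m1 \x^ m2]_z (\1_A z)%:E = \int[m2]_y \int[m1]_x (\1_A (x, y))%:E.
Proof.
move=> mA; rewrite integral_indic// setIT; apply: eq_integral => y _.
by have /(congr1 (@^~ y)) := indic_fubini_tonelli_GE m1 mA.
Qed.

Lemma integral_product2_nnsfun (f : {nnsfun T1 * T2 >-> R}) :
  \int[m1 \x^ m2]_z (f z)%:E = \int[m2]_y \int[m1]_x (f (x, y))%:E.
Proof.
have fE z : (f z)%:E = \sum_(c \in range f) c%:E * (\1_(f @^-1` [set c]) z)%:E.
  by rewrite fsumEFin //= fimfunE.
have mI c : measurable_fun setT (fun z : T1 * T2 => (\1_(f @^-1` [set c]) z)%:E : \bar R).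
  exact/measurable_EFinP.
have mIl c y : measurable_fun setT (fun x : T1 => (\1_(f @^-1` [set c]) (x, y))%:E : \bar R).
  exact/measurable_EFinP/measurableT_comp.
have mG c : measurable_fun setT
    (fun y : T2 => \int[m1]_x (\1_(f @^-1` [set c]) (x, y))%:E).
  exact: (measurable_fun_fubini_tonelli_G (fun z => (\1_(f @^-1` [set c]) z)%:E)).
have ge0 c z : 0 <= c%:E * (\1_(f @^-1` [set c]) z)%:E :> \bar R.
  exact: nnfun_muleindic_ge0.
have c0 c : c \in range f -> 0 <= c%:E :> \bar R.
  by rewrite inE => -[z _ <-]; rewrite lee_fin.
have geG c y : 0 <= c%:E * \int[m1]_x (\1_(f @^-1` [set c]) (x, y))%:E.
  (* A value [c] outside the range of [f] may be negative, but its level set is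
     empty. *)
  have [cf|cf] := boolP (c \in range f).
    by rewrite mule_ge0 ?c0// integral_ge0// => x _; rewrite lee_fin.
  rewrite integral0_eq ?mule0// => x _; rewrite indicE notin_setE in cf *.
  by rewrite memNset// => fc; apply: cf; exists (x, y).
rewrite (eq_integral
  (fun z => \sum_(c \in range f) c%:E * (\1_(f @^-1` [set c]) z)%:E)%E); last first.
  by move=> z _; exact: fE.
rewrite ge0_integral_fsum//; last by move=> c; exact: measurable_funeM.
transitivity (\sum_(c \in range f)
    \int[m2]_y (c%:E * \int[m1]_x (\1_(f @^-1` [set c]) (x, y))%:E)).
  apply: eq_fsbigr => c cf.
  rewrite ge0_integralZl ?c0// integral_product2_indic// -ge0_integralZl ?c0//.
  by move=> y _; rewrite integral_ge0// => x _; rewrite lee_fin.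
rewrite -ge0_integral_fsum//; last by move=> c; exact: measurable_funeM.
transitivity (\int[m2]_y \int[m1]_x
    \sum_(c \in range f) c%:E * (\1_(f @^-1` [set c]) (x, y))%:E)%E; last first.
  by apply: eq_integral => y _; apply: eq_integral => x _; rewrite fE.
apply: eq_integral => y _.
rewrite ge0_integral_fsum//; last by move=> c; exact: measurable_funeM.
by apply: eq_fsbigr => c cf; rewrite ge0_integralZl ?c0.
Qed.

(** By definition, [m1 \x^ m2] measures a set by integrating the [m1]-measures
    of its sections against [m2]. This is the claim for indicators; linearity and
    monotone convergence extend it to nonnegative functions. Sigma-finiteness of
    [m1] is what makes the measures of the sections measurable. *)
Lemma ge0_integral_product2 (f : T1 * T2 -> \bar R) :
  measurable_fun setT f -> (forall z, 0 <= f z) ->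
  \int[m1 \x^ m2]_z f z = \int[m2]_y \int[m1]_x f (x, y).
Proof.
move=> mf f0; pose g := nnsfun_approx measurableT mf.
have gf z : f z = limn (fun n => (g n z)%:E).
  by apply/esym/cvg_lim => //; exact: cvg_nnsfun_approx.
have gnd z : {homo (fun n => (g n z)%:E) : n m / (n <= m)%N >-> n <= m}.
  by move=> n m nm; rewrite lee_fin; exact/lefP/nd_nnsfun_approx.
have mgl n y : measurable_fun setT (fun x => (g n (x, y))%:E).
  exact/measurable_EFinP/measurableT_comp.
have g0 n z : 0 <= (g n z)%:E by rewrite lee_fin; exact: fun_ge0.
transitivity (limn (fun n => \int[m1 \x^ m2]_z (g n z)%:E)).
  rewrite -monotone_convergence//; first by apply: eq_integral => z _; exact: gf.
  by move=> n; exact/measurable_EFinP.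
transitivity (limn (fun n => \int[m2]_y \int[m1]_x (g n (x, y))%:E)).
  by congr (limn _); apply/funext => n; exact: integral_product2_nnsfun.
rewrite -monotone_convergence//.
- apply: eq_integral => y _; rewrite -monotone_convergence//.
  by apply: eq_integral => x _; rewrite gf.
- move=> n; apply: (measurable_fun_fubini_tonelli_G (fun z => (g n z)%:E)) => //.
  exact/measurable_EFinP.
- by move=> n y _; exact: integral_ge0.
- by move=> y _ n m nm; apply: ge0_le_integral => // x _; exact: gnd.
Qed.

Lemma ge0_integral_product2_setX (A : set T1) (D : set T2) (f : T1 * T2 -> \bar R) :
  measurable A -> measurable D -> measurable_fun (A `*` D) f ->
  (forall z, (A `*` D) z -> 0 <= f z) ->
  \int[m1 \x^ m2]_(z in A `*` D) f z =
  \int[m2]_(y in D) \int[m1]_(x in A) f (x, y).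
Proof.
move=> mA mD mf f0; rewrite [LHS]integral_mkcond ge0_integral_product2; first last.
- by move=> z; rewrite patchE; case: ifPn => // /set_mem; exact: f0.
- by apply/(measurable_restrictT _ _).1 => //; exact: measurableX.
rewrite [RHS]integral_mkcond; apply: eq_integral => y _; rewrite patchE.
case: ifPn => [/set_mem Dy|/negP Dy].
  rewrite [RHS]integral_mkcond; apply: eq_integral => x _; rewrite !patchE.
  congr (if _ then _ else _); apply/idP/idP => /set_mem; rewrite inE.
    by case.
  by move=> Ax; split.
apply: integral0_eq => x _; rewrite patchE ifF//; apply/negP => /set_mem [_ /=].
by move/mem_set/Dy.
Qed.

End tonelli.

(** * Measurability of jets *)

Section measurable_vectors.
Context {R : realType} {n : nat}.

Lemma measurable_coord (i : 'I_n) :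
  measurable_fun setT (fun x : 'rV[R]_n => x 0 i).
Proof.
apply: (measurability _ (RGenOpens.measurableE R)) => _ [_ [a [b ->] <-]].
rewrite setTI; apply: open_measurable_mx.
by have /continuousP := @coord_continuous R 1 n ord0 i; apply; exact: interval_open.
Qed.

Lemma measurable_rV_in d (T : measurableType d) (D : set T) (f : T -> 'rV[R]_n) :
  measurable D -> (forall i, measurable_fun D (fun t => f t 0 i)) ->
  measurable_fun D f.
Proof.
move=> mD mf.
have mfD : measurable_fun setT (fun t => if t \in D then f t else 0).
  apply: measurable_rV => i; have /(measurable_restrictT _ mD).1 := mf i.
  apply: eq_measurable_fun => t _; rewrite patchE.
  by case: ifP => //; rewrite mxE.
by apply: (eq_measurable_fun _ _ (measurable_funTS mfD)) => t ->.
Qed.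

End measurable_vectors.

Lemma measurable_jet (R : realType) (r : nat) (D : set 'rV[R]_3)
    (G : seq 'I_3 -> 'I_3 -> 'rV[R]_3 -> R) : measurable D ->
  (forall alpha i, (size alpha <= r)%N -> measurable_fun D (G alpha i)) ->
  measurable_fun D (fun x => jet r (fun alpha i => G alpha i x) x).
Proof.
move=> mD mG; apply: measurable_rV_in => // c.
rewrite (_ : (fun x => _) = fun x : 'rV[R]_3 => match @fintype.split 3 _ c with
  | inl a => x 0 a
  | inr b => G [seq digit (tagnat.sig2 b) m | m <- iota 1 (tagnat.sig1 b)]
               (digit (tagnat.sig2 b) 0) x
  end); last first.
  by apply/funext => x; rewrite mxE; case: fintype.split => // b; rewrite !mxE.
case: fintype.split => [a|b].
  by apply: measurable_funTS; exact: measurable_coord.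
by apply: mG; rewrite size_map size_iota -ltnS.
Qed.

Lemma measurable_bd (R : realType) (Omega : set 'rV[R]_3) : measurable (bd Omega).
Proof.
apply: measurableD; last by apply: open_measurable_mx; exact: open_interior.
rewrite -[closure _]setCK; apply: measurableC; apply: open_measurable_mx; apply: closed_openC.
exact: closed_closure.
Qed.

(** * The intensity of cracks up to a given time *)

Section time.
Context {R : realType} (k : time_axis).

Let exists_nat_gt (t : R) : exists N : nat, t < N%:R.
Proof.
exists (Num.bound `|t|).
exact: le_lt_trans (ler_norm t) (archi_boundP (normr_ge0 t)).
Qed.

Definition time_until (t : R) : set R := time_set k `&` [set s | s <= t].

Lemma compact_time_until t : compact (time_until t).
Proof.
rewrite /time_until /time_set; case: k.
  apply: finite_compact; have [N tN] := exists_nat_gt t.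
  apply: (@sub_finite_set _ _ ((fun n : nat => n%:R) @` `I_N)).
    move=> _ [[n _ <-] /= nt]; exists n => //=.
    by rewrite -(ltr_nat R) (le_lt_trans nt).
  exact/finite_image/finite_II.
rewrite (_ : _ `&` _ = `[0, t]%classic); first exact: segment_compact.
by apply/seteqP; split => s /=; rewrite in_itv/= => /andP.
Qed.

Lemma measurable_time_until t : measurable (time_until t).
Proof. by apply: compact_measurable; exact: compact_time_until. Qed.

Lemma measurable_time_set : measurable (time_set k : set R).
Proof.
rewrite (_ : time_set k = \bigcup_n time_until n%:R).
  by apply: bigcupT_measurable => n; exact: measurable_time_until.
apply/seteqP; split => [t kt|t [n _ []]//].
have [N tN] := exists_nat_gt t.
by exists N => //; split => //=; exact: ltW.
Qed.

Lemma time_measure_until_lty t : (time_measure k (time_until t) < +oo)%E.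
Proof.
rewrite /time_measure /time_until /time_set; case: k.
  have [N tN] := exists_nat_gt t.
  rewrite /counting asboolT ?ltry//; apply: (sub_finite_set _ (finite_II N)).
  by move=> n [_ nt]; rewrite /= -(ltr_nat R) (le_lt_trans nt).
apply: (@le_lt_trans _ _ (lebesgue_measure (`[0, t]%classic : set R))).
  apply: le_measure; rewrite ?inE//; last first.
    by move=> s [[/= s0 st] _] /=; rewrite in_itv/= s0.
  rewrite (_ : _ `&` _ `&` _ = `[0, t]%classic) ?measurable_itv//.
  apply/seteqP; split => [s [[/= s0 st] _]|s /=]; rewrite /= in_itv/= ?s0//.
  by case/andP.
by rewrite lebesgue_measure_itv/=; case: ifP => // _; exact: ltry.
Qed.

(** The cracks up to time [t] that lie in the body or on its boundary form the
    product of the times up to [t] with the body or its boundary, so that Tonelli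
    splits off the time integral of the intensity functions. *)
Lemma crack_intensity_until r (rho_vol rho_sur : R -> 'rV[R]_(jet_dim r) -> R)
    (Oext Omega : set 'rV[R]_3) (y : 'rV[R]_3 -> 'rV[R]_3) (t : R) :
  intensity_function k rho_vol -> intensity_function k rho_sur ->
  open Omega -> closure Omega `<=` Oext -> regular_displacement r Omega y ->
  crack_intensity k rho_vol rho_sur Omega y (cracks_until k Oext t) =
  shape_cost (time_integral k t rho_vol) (time_integral k t rho_sur) Omega y.
Proof.
move=> rhov rhos oO cO reg.
have slab D : D `<=` Oext ->
    cracks_until k Oext t `&` (time_set k `*` D) = time_until t `*` D.
  move=> DO; apply/seteqP; split => [[s x] [[/= _ st] []]//|[s x] [[/= ks st] Dx]].
  by split; split => //; split => //; exact: DO.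
have cost (m : {measure set 'rV[R]_3 -> \bar R}) D rho (J : 'rV[R]_3 -> 'rV[R]_(jet_dim r)) :
    D `<=` Oext -> measurable D -> intensity_function k rho -> measurable_fun D J ->
    (\int[time_measure k \x^ m]_(z in cracks_until k Oext t `&` (time_set k `*` D))
      (rho z.1 (J z.2))%:E = \int[m]_(x in D) time_integral k t rho (J x))%E.
  move=> DO mD [mrho rho0] mJ; rewrite slab//.
  have mJ' : measurable_fun setT (J \_ D) by apply/(measurable_restrictT _ mD).
  rewrite ge0_integral_product2_setX//; first exact: measurable_time_until.
    apply/measurable_EFinP.
    apply: (@eq_measurable_fun _ _ _ _ _
      ((fun z : R * 'rV[R]_(jet_dim r) => rho z.1 z.2) \o
       (fun z : R * 'rV[R]_3 => (z.1, (J \_ D) z.2)))).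
      by move=> [s x] /set_mem[_ /= Dx]; rewrite patchE mem_set.
    apply: (measurable_comp _ _ mrho).
    - by apply: measurableX => //; exact: measurable_time_set.
    - by move=> _ [[s x] [[/= ks _] _] <-].
    apply: measurable_funTS; apply: measurable_fun_pair => //.
    exact: measurableT_comp mJ' measurable_snd.
  by move=> [s x] [[/= ks _] _]; rewrite lee_fin; exact: rho0.
have OO : Omega `<=` Oext by move=> x /subset_closure/cO.
rewrite /crack_intensity /shape_cost; congr (_ + _)%E; apply: cost => //.
- exact: open_measurable_mx.
- apply: measurable_jet; first exact: open_measurable_mx.
  move=> alpha i ar; have [[h hP] _] := reg alpha i ar; rewrite /weak_deriv.
  case: alpha ar hP => [|j alpha] ar hP; first by case: hP => -[].
  by have [_ []] := xgetPex (cst 0)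
    (ex_intro [set h | is_weak_deriv Omega (vcomp y i) (j :: alpha) h] h hP).
- by move=> x [/cO].
- exact: measurable_bd.
- apply: measurable_jet; first exact: measurable_bd.
  move=> alpha i ar; have [_ [w0 w0P]] := reg alpha i ar.
  by have [] := xgetPex (cst 0)
    (ex_intro [set h | is_trace Omega (weak_deriv Omega (vcomp y i) alpha) h] w0 w0P).
Qed.

End time.

(** * The law of the first crack *)

Section first_crack.
Context {R : realType} (k : time_axis) (Oext : set 'rV[R]_3).

Lemma bounded_borel_cracks_until t :
  bounded_set Oext -> bounded_borel k Oext (cracks_until k Oext t).
Proof.
move=> bO; split; last 2 first.
- by move=> z [].
- have bO' : \forall M \near +oo, forall x, Oext x -> `|x| <= M := bO.
  suff : \forall M \near +oo, forall z, cracks_until k Oext t z -> `|z| <= M by [].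
  near=> M; move=> [s x] [[/= ks xO] st].
  rewrite prod_normE/= ge_max; apply/andP; split.
    rewrite ger0_norm.
      by rewrite (le_trans st)//; near: M; exact: nbhs_pinfty_ge.
    by case: (k) ks => [[n _ <-]|//].
  by move: x xO; near: M; exact: bO'.
rewrite (_ : cracks_until k Oext t =
    cracks k Oext `&` (`]-oo, t]%classic `*` [set: 'rV[R]_3])); last first.
  by apply/seteqP; split => [[s x] [? /= st]|[s x] [? [/=]]]; rewrite in_itv.
apply: (@measurableI _ (crack_space k Oext)); apply: sub_sigma_algebra.
  by right.
left; apply: measurableX => //; exact: measurable_itv.
Unshelve. all: by end_near. Qed.

(** If the infimum [tau] is at most [t], there are cracks up to every time t + e
    with e > 0. The number of these cracks decreases to the number of cracks up
    to [t] as e tends to 0 and is an integer, so that it cannot be positive for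
    all e > 0 and 0 in the limit. Conversely, cracks up to [t] are cracks up to
    t + e, and t + e is positive, as the definition of [tau] requires, even for
    t = 0. *)
Lemma tau_leP (N : {measure set (crack_space k Oext) -> \bar R}) t :
  bounded_set Oext -> 0 <= t ->
  (forall B, bounded_borel k Oext B -> exists n : nat, N B = n%:R%:E) ->
  (tau k Oext N <= t%:E)%E <-> ~ N (cracks_until k Oext t) = 0%E.
Proof.
move=> bO t0 Nint; have bbC s := bounded_borel_cracks_until s bO.
have mC s : measurable (cracks_until k Oext s : set (crack_space k Oext)).
  by case: (bbC s).
have leC s s' : s <= s' -> (N (cracks_until k Oext s) <= N (cracks_until k Oext s'))%E.
  move=> ss'; apply: le_measure; rewrite ?inE//.
  by move=> z [cz zs]; split => //; exact: le_trans zs ss'.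
split=> [taut Nt0|/eqP Nt0].
- pose F n := cracks_until k Oext (t + n.+1%:R^-1) : set (crack_space k Oext).
  have FE : \bigcap_n F n = cracks_until k Oext t.
    apply/seteqP; split => [z zF|z [cz zt] n _].
      split; first by case: (zF 0%N Logic.I).
      apply/ler_addgt0Pl => e e0; have [n ne] := ltr_add_invr e0.
      have [_ zn] := zF n Logic.I; apply: (le_trans zn).
      by rewrite addrC lerD2r ltW// -[_^-1]add0r.
    by split => //; apply: (le_trans zt); rewrite lerDl.
  have cvgF : (N \o F) @ \oo --> N (\bigcap_n F n).
    apply: nonincreasing_cvg_mu => //.
    - by have [n ->] := Nint _ (bbC (t + 1%:R^-1)); exact: ltry.
    - by move=> n; exact: mC.
    - by rewrite FE; exact: mC.
    - move=> n m nm; apply/subsetPset => z [cz zm]; split => //.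
      by apply: (le_trans zm); rewrite lerD2l lef_pV2 ?posrE// ler_nat.
  move: cvgF; rewrite FE Nt0 => cvgF.
  have [n _ /(_ n (leqnn n)) /= Fn1] : \forall n \near \oo, (N (F n) < 1)%E.
    by apply: (cvgF [set y | (y < 1)%E]); apply: open_ereal_lt'; rewrite lte_fin.
  have Fn0 : N (F n) = 0%E.
    have [m Fm] := Nint _ (bbC (t + n.+1%:R^-1)).
    move: Fn1; rewrite /F Fm lte_fin -[1]/(1%:R) ltr_nat ltnS leqn0.
    by move=> /eqP ->.
  have : ((t + n.+1%:R^-1)%:E <= tau k Oext N)%E.
    apply: le_ereal_inf_tmp => _ [s [s0 Ns] <-]; rewrite lee_fin leNgt.
    apply/negP => /ltW/leC; rewrite -/(F n) Fn0 leNgt.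
    by move/negP; apply.
  by move=> /le_trans/(_ taut); rewrite lee_fin gerDl leNgt invr_gt0 ltr0n.
- apply/lee_addgt0Pr => e e0.
  apply: ereal_inf_lbound; exists (t + e); last by rewrite EFinD.
  split; first by rewrite ltr_wpDl.
  rewrite (lt_le_trans _ (leC t _ _)) ?lerDl ?ltW//.
  by rewrite lt0e Nt0 measure_ge0.
Qed.

(** The void probability of the Poisson process: the law with [n] = 0. *)
Lemma prob_crack_until d (X : measurableType d) (P : probability X R)
    (rho : set (R * 'rV[R]_3) -> \bar R)
    (N : X -> {measure set (crack_space k Oext) -> \bar R}) t :
  bounded_set Oext -> 0 <= t -> poisson_process P rho N ->
  (P [set w | (tau k Oext (N w) <= t%:E)%E] =
   1 - (expR (- fine (rho (cracks_until k Oext t))))%:E)%E.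
Proof.
move=> bO t0 [mN Nint Npois _].
have bbC := bounded_borel_cracks_until t bO; have [mC CC _] := bbC.
rewrite (_ : [set w | _] = ~` [set w | N w (cracks_until k Oext t) = 0%E]).
  rewrite probability_setC.
    by congr (_ - _)%E; rewrite (Npois _ 0%N bbC) expr0 mulr1 fact0 divr1.
  have := mN _ mC CC measurableT [set 0%E] (emeasurable_set1 _).
  by rewrite setTI.
by apply/seteqP; split => w; move/(tau_leP bO t0 (Nint w)).
Qed.

End first_crack.

(** * Integrals of continuous families of functions *)

Section compact_families.
Context {R : realType} {n : nat}.
Implicit Types (S K : set R) (phi : R -> 'rV[R]_n -> R) (z : 'rV[R]_n).

(** Continuity of the parametrised family for locally uniform convergence on R^n,
    the topology of C^0(S; C^0(R^n)). *)
Definition compactly_continuous S phi : Prop :=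
  {within S, continuous (fun t => phi t : {family compact, 'rV[R]_n -> R})}.

Lemma compact_closed_ball_rV z (e : R) : 0 < e -> compact (closed_ball z e).
Proof.
move=> e0; apply: bounded_closed_compact; last exact: closed_ball_closed.
rewrite closed_ballE//; exists (`|z| + e); split=> [|M]; first exact: num_real.
move=> zM y /= yz.
rewrite (le_trans _ (ltW zM))// -[y](subrK z) (le_trans (ler_normD _ _))//.
by rewrite addrC lerD2l distrC.
Qed.

Lemma compactly_continuousP S phi t (C : set 'rV[R]_n) (e : R) :
  compactly_continuous S phi -> S t -> compact C -> 0 < e ->
  \forall s \near t, S s -> forall z, C z -> `|phi t z - phi s z| < e.
Proof.
move=> cphi St cC e0.
have : nbhs (t : subspace S) [set s | forall z, C z -> ball (phi t z) e (phi s z)].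
  exact: cphi t _ (fam_nbhs (phi t) (entourage_ball _ (PosNum e0)) cC).
by have -> : nbhs (t : subspace S) = within S (nbhs t) by rewrite (nbhs_subspace_in St).
Qed.

Lemma compactly_continuous_pointwise S phi z :
  compactly_continuous S phi -> {within S, continuous (fun t => phi t z)}.
Proof.
move=> cphi t; apply/cvgrPdist_lt => e e0.
have [St|nSt] := pselect (S t); last first.
  rewrite /nbhs_subspace memNset//.
  by move=> _ ->; rewrite subrr normr0.
have := compactly_continuousP cphi St (@compact_set1 _ z) e0.
rewrite /nbhs_subspace mem_set//.
by apply: filterS => s /[apply]; exact.
Qed.

(** Around each parameter, the family is uniformly close on a compact
    neighbourhood of [z] to a single continuous function; finitely many of the
    parameters suffice since [K] is compact. *)
Lemma compactly_equicontinuous S K phi z (e : R) :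
  compactly_continuous S phi -> compact K -> K `<=` S ->
  (forall t, K t -> continuous (phi t)) -> 0 < e ->
  \forall y \near z, forall t, K t -> `|phi t z - phi t y| <= e.
Proof.
move=> cphi cK KS cphit e0.
pose C := closed_ball z 1.
have Cz : \forall y \near z, C y.
  exact: (filterS (@subset_closed_ball _ _ z 1) (nbhsx_ballx z 1 ltr01)).
have cC : compact C by exact: compact_closed_ball_rV.
have e3 : 0 < e / 3 by rewrite divr_gt0.
have /near_covering_withinP cover := (compact_near_coveringP K).1 cK.
apply: (cover _ (nbhs z) (fun y t => `|phi t z - phi t y| <= e) _) => t Kt.
have ct := compactly_continuousP cphi (KS _ Kt) cC e3.
have cz : \forall y \near z, `|phi t z - phi t y| < e / 3.
  by have /cvgrPdist_lt := cphit t Kt z; exact.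
near=> s y => Ks.
have Cy : C y by near: y.
have ts x : C x -> `|phi t x - phi s x| < e / 3.
  by move: x; have : S s := KS _ Ks; near: s.
have zy : `|phi t z - phi t y| < e / 3 by near: y.
(* Compare with the function at the nearby parameter [t]. *)
rewrite (_ : phi s z - phi s y = (phi t z - phi t y) - (phi t z - phi s z) +
  (phi t y - phi s y)); last by lra.
have zs := ts z (nbhs_singleton Cz); have ys := ts y Cy.
rewrite (le_trans (ler_normD _ _))//.
have := ler_normB (phi t z - phi t y) (phi t z - phi s z); lra.
Unshelve. all: by end_near. Qed.

Lemma integrable_compactly_continuous S K phi z (mu : {measure set R -> \bar R}) :
  compactly_continuous S phi -> compact K -> K `<=` S -> (mu K < +oo)%E ->
  mu.-integrable K (fun t => (phi t z)%:E).
Proof.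
move=> cphi cK KS muK.
have cphiz : {within K, continuous (fun t => phi t z)}.
  apply: (continuous_subspaceW KS); exact: compactly_continuous_pointwise.
have mK : measurable K by exact: compact_measurable.
apply: (@measurable_bounded_integrable _ _ _ _ (fun t => phi t z)) => //.
  exact: subspace_continuous_measurable_fun.
have /compact_bounded[M [_ Mb]] := continuous_compact cphiz cK.
exists M; split; first exact: num_real.
by move=> x Mx t Kt; apply: (Mb x Mx); exists t.
Qed.

(** The mean value theorem on the line through [z]; it writes difference quotients
    as values of the derivative at nearby points, so that equicontinuity of the
    derivatives controls them uniformly in a parameter. *)
Lemma directional_MVT (g : 'rV[R]_n -> R) z v (h : R) :
  (forall y, derivable g y v) -> h != 0 ->
  exists2 c, `|c| <= `|h| &
    h^-1 * (g (h *: v + z) - g z) = 'D_v g (c *: v + z).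
Proof.
move=> dg h0; pose p (s : R) := g (s *: v + z).
have dp (s : R) : is_derive s 1 p ('D_v g (s *: v + z)).
  have pE : (fun k : R => k^-1 *: ((p \o shift s) (k *: 1) - p s)) =
      (fun k => k^-1 *: ((g \o shift (s *: v + z)) (k *: v) - g (s *: v + z))).
    apply/funext => k; rewrite /p /=; congr (_ *: (g _ - _)).
    by rewrite [k *: 1]mulr1 scalerDl addrA.
  by split; rewrite /derivable /derive pE//; exact: dg.
have cp a b : {within `[a, b], continuous p}.
  by apply: derivable_within_continuous => s _; case: (dp s).
have p0 : p 0 = g z by rewrite /p scale0r add0r.
have [hlt|hgt|/eqP] := ltgtP h 0; last by rewrite (negPf h0).
- have [c] := MVT hlt (fun s _ => dp s) (cp h 0).
  rewrite in_itv/= => /andP[hc c0] pc; exists c.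
    by rewrite ltr0_norm// ltr0_norm// lerN2 ltW.
  rewrite -p0 -/(p h) (_ : p h - p 0 = 'D_v g (c *: v + z) * h); last by lra.
  by rewrite mulrC mulfK.
- have [c] := MVT hgt (fun s _ => dp s) (cp 0 h).
  rewrite in_itv/= => /andP[c0 ch] pc; exists c.
    by rewrite !gtr0_norm// ltW.
  by rewrite -p0 -/(p h) pc subr0 mulrC mulfK.
Qed.

Section under_integral.
Variables (mu : {measure set R -> \bar R}) (S K : set R).
Hypotheses (cK : compact K) (KS : K `<=` S) (muK : (mu K < +oo)%E).

Let mK : measurable K. Proof. exact: compact_measurable. Qed.

Let integrableB_EFin (a b : R -> R) :
  mu.-integrable K (EFin \o a) -> mu.-integrable K (EFin \o b) ->
  mu.-integrable K (EFin \o (fun t => a t - b t)).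
Proof. by move=> ia ib; exact: integrableB ia ib. Qed.

Lemma Rintegral_dist_le (a b : R -> R) (e : R) :
  mu.-integrable K (EFin \o a) -> mu.-integrable K (EFin \o b) -> 0 <= e ->
  (forall t, K t -> `|a t - b t| <= e) ->
  `|\int[mu]_(t in K) a t - \int[mu]_(t in K) b t| <= e * fine (mu K).
Proof.
move=> ia ib e0 abe; rewrite -RintegralB//.
have iab := integrableB_EFin ia ib.
rewrite (le_trans (le_normr_Rintegral mK iab))// -Rintegral_cst//.
apply: le_Rintegral => //.
  exact: integrable_norm iab.
by apply: measurable_bounded_integrable => //; exact: bounded_cst.
Qed.

Lemma continuous_Rintegral phi :
  compactly_continuous S phi -> (forall t, K t -> continuous (phi t)) ->
  continuous (fun z => \int[mu]_(t in K) phi t z).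
Proof.
move=> cphi cphit z; apply/(@cvgrPdist_le _ _ _ (nbhs z)) => e e0.
have m0 : 0 < fine (mu K) + 1 by rewrite ltr_wpDl// fine_ge0.
(* Adding 1 to the measure of [K] avoids a division by 0. *)
have em0 : 0 < e / (fine (mu K) + 1) by rewrite divr_gt0.
have := compactly_equicontinuous z cphi cK KS cphit em0.
apply: filterS => y zy.
apply: (le_trans (Rintegral_dist_le _ _ (ltW em0) zy)).
- exact: integrable_compactly_continuous cphi cK KS muK.
- exact: integrable_compactly_continuous cphi cK KS muK.
by rewrite mulrAC ler_pdivrMr// ler_pM2l// lerDl.
Qed.

(** Both sides of the limit are integrals over [K]. By the mean value theorem and
    equicontinuity of the derivatives, the difference quotients tend to the
    derivatives uniformly on [K], which has finite measure. *)
Lemma is_derive_Rintegral phi v z :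
  compactly_continuous S phi ->
  compactly_continuous S (fun t => 'D_v (phi t)) ->
  (forall t, K t -> continuous ('D_v (phi t))) ->
  (forall t y, K t -> derivable (phi t) y v) ->
  is_derive z v (fun y => \int[mu]_(t in K) phi t y)
    (\int[mu]_(t in K) 'D_v (phi t) z).
Proof.
move=> cphi cD cDt dphi; set F := fun y => _; set D := \int[mu]_(t in K) _.
suff FD : (fun h => h^-1 *: ((F \o shift z) (h *: v) - F z)) @ 0^' --> D.
  by split; [apply/cvg_ex; exists D|exact/cvg_lim].
apply/cvgrPdist_le => e e0.
have m0 : 0 < fine (mu K) + 1 by rewrite ltr_wpDl// fine_ge0.
have em0 : 0 < e / (fine (mu K) + 1) by rewrite divr_gt0.
have near_z := compactly_equicontinuous z cD cK KS cDt em0.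
(* All points of the segment from [z] to [h *: v + z] lie in the neighbourhood
   of [z] given by equicontinuity when [h] is small. *)
have line : (fun c : R => c *: v + z) @ 0 --> z.
  rewrite -[X in _ --> X]add0r -[X in _ --> X + _](scale0r v).
  by apply: cvgD; [exact: scalel_continuous|exact: cvg_cst].
have /nbhs_ballP[d /= d0 dz] := line _ near_z.
have iphi y := integrable_compactly_continuous y cphi cK KS muK.
near=> h.
have h0 : h != 0 by near: h; exact: nbhs_dnbhs_neq.
have hd : `|h| < d by near: h; exact: dnbhs0_lt.
have -> : h^-1 *: ((F \o shift z) (h *: v) - F z) =
    \int[mu]_(t in K) (h^-1 * (phi t (h *: v + z) - phi t z)).
  rewrite RintegralZl//; last exact: (integrableB_EFin (iphi _) (iphi _)).
  by rewrite RintegralB//; exact: iphi.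
apply: (@le_trans _ _ (e / (fine (mu K) + 1) * fine (mu K))); last first.
  by rewrite mulrAC ler_pdivrMr// ler_pM2l// lerDl.
apply: Rintegral_dist_le; [| |exact: ltW|].
- exact: integrable_compactly_continuous cD cK KS muK.
- exact: (integrableZl mK h^-1 (integrableB_EFin (iphi _) (iphi _))).
- move=> t Kt; have [c ch ->] := directional_MVT z (fun y => dphi t y Kt) h0.
  by apply: (dz c) => //; rewrite -ball_normE /= sub0r normrN (le_lt_trans ch).
Unshelve. all: by end_near. Qed.

Lemma pderiv_Rintegral s phi (alpha : seq 'I_n) :
  (forall beta, (size beta <= s)%N ->
    compactly_continuous S (fun t => pderiv beta (phi t))) ->
  (forall t, K t -> is_Cs s (phi t)) -> (size alpha <= s)%N ->
  pderiv alpha (fun z => \int[mu]_(t in K) phi t z) =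
  fun z => \int[mu]_(t in K) pderiv alpha (phi t) z.
Proof.
move=> cphi Cphi; elim: alpha => //= i alpha IH als.
rewrite IH 1?ltnW//; apply/funext => z.
have [_ ->//] : is_derive z (delta_mx 0 i)
  (fun y => \int[mu]_(t in K) pderiv alpha (phi t) y)
  (\int[mu]_(t in K) 'D_(delta_mx 0 i) (pderiv alpha (phi t)) z).
apply: is_derive_Rintegral.
- by apply: cphi; rewrite ltnW.
- exact: (cphi (i :: alpha)).
- by move=> t Kt; have [] := Cphi t Kt (i :: alpha) als.
- by move=> t y Kt; have [_] := Cphi t Kt alpha (ltnW als); exact.
Qed.

Lemma is_Cs_Rintegral s phi :
  (forall beta, (size beta <= s)%N ->
    compactly_continuous S (fun t => pderiv beta (phi t))) ->
  (forall t, K t -> is_Cs s (phi t)) ->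
  is_Cs s (fun z => \int[mu]_(t in K) phi t z).
Proof.
move=> cphi Cphi alpha als; rewrite (pderiv_Rintegral cphi Cphi als); split.
  apply: continuous_Rintegral; first exact: cphi.
  by move=> t Kt; have [] := Cphi t Kt alpha als.
move=> als' i z; suff [] : is_derive z (delta_mx 0 i)
  (fun y => \int[mu]_(t in K) pderiv alpha (phi t) y)
  (\int[mu]_(t in K) 'D_(delta_mx 0 i) (pderiv alpha (phi t)) z) by [].
apply: is_derive_Rintegral; first exact: cphi.
- exact: (cphi (i :: alpha)).
- by move=> t Kt; have [] := Cphi t Kt (i :: alpha) als'.
- by move=> t y Kt; have [_] := Cphi t Kt alpha als; exact.
Qed.

End under_integral.

End compact_families.

(** * The time integrals and the equivalence *)

Lemma time_set_ge0 (R : realType) (k : time_axis) (t : R) :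
  time_set k t -> 0 <= t.
Proof. by case: k => // -[n _ <-]. Qed.

(** The compact set of integration is the set of times up to [t], for discrete as
    well as for continuous time. *)
Lemma time_integral_Cs (R : realType) (k : time_axis) (n s : nat) (t : R)
    (rho : R -> 'rV[R]_n -> R) :
  s_regular k s rho ->
  exists2 F : 'rV[R]_n -> R, is_Cs s F & forall z, time_integral k t rho z = (F z)%:E.
Proof.
move=> [rhoCs rhoc].
have cK := @compact_time_until R k t; have muK := @time_measure_until_lty R k t.
have KS : time_until k t `<=` time_set k by move=> x [].
exists (fun z => \int[time_measure k]_(x in time_until k t) rho x z).
  apply: (is_Cs_Rintegral cK KS muK rhoc) => x /KS; exact: rhoCs.
move=> z; rewrite /Rintegral fineK//; apply: integrable_fin_num.
  exact: measurable_time_until.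
exact: (integrable_compactly_continuous z (rhoc [::] isT) cK KS muK).
Qed.

Theorem lemma2p7 (R : realType) (k : time_axis)
  (Oext : set 'rV[R]_3) (shapes : set (set 'rV[R]_3))
  (bdD bdN : set 'rV[R]_3 -> set 'rV[R]_3) (lambda mu : R)
  (Vvol Vsur : set ('rV[R]_3 -> 'rV[R]_3)) (f g : 'rV[R]_3 -> 'rV[R]_3)
  (r : nat) (rho_vol rho_sur : R -> 'rV[R]_(jet_dim r) -> R)
  (d : measure_display) (X : measurableType d) (P : probability X R)
  (gamma : set 'rV[R]_3 -> X -> {measure set (crack_space k Oext) -> \bar R})
  (tstar : R)
  (u := fun Omega => displacement lambda mu Omega (bdD Omega) (bdN Omega) f g)
  (T := fun Omega w => tau k Oext (gamma Omega w))
  (Fvol := time_integral k tstar rho_vol)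
  (Fsur := time_integral k tstar rho_sur)
  (J := shape_cost Fvol Fsur) :
  bounded_set Oext ->
  (forall Omega, shapes Omega ->
    lipschitz_domain Omega /\ closure Omega `<=` Oext) ->
  (forall Omega, shapes Omega ->
    boundary_partition Omega (bdD Omega) (bdN Omega)) ->
  0 < lambda -> 0 < mu ->
  (forall Omega f' g', shapes Omega -> Vvol f' -> Vsur g' ->
    unique_weak_solution lambda mu Omega (bdD Omega) (bdN Omega) f' g') ->
  Vvol f -> Vsur g ->
  (forall Omega, shapes Omega -> regular_displacement r Omega (u Omega)) ->
  intensity_function k rho_vol -> intensity_function k rho_sur ->
  (forall Omega, shapes Omega ->
    is_radon k Oext (crack_intensity k rho_vol rho_sur Omega (u Omega))) ->
  (forall Omega, shapes Omega ->
    poisson_process P (crack_intensity k rho_vol rho_sur Omega (u Omega))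
      (gamma Omega)) ->
  time_set k tstar ->
  (forall Omega_star, shapes Omega_star ->
    ((forall Omega, shapes Omega ->
        (P [set w | T Omega_star w <= tstar%:E]
         <= P [set w | T Omega w <= tstar%:E])%E)
     <->
     (forall Omega, shapes Omega ->
        (J Omega_star (u Omega_star) <= J Omega (u Omega))%E)))
  /\
  (forall s : nat, s_regular k s rho_vol -> s_regular k s rho_sur ->
    (exists2 F : 'rV[R]_(jet_dim r) -> R, is_Cs s F & forall z, Fvol z = (F z)%:E)
    /\
    (exists2 F : 'rV[R]_(jet_dim r) -> R, is_Cs s F & forall z, Fsur z = (F z)%:E)).
Proof.
move=> bO Olip _ _ _ _ _ _ ureg rhov rhos radon pois kt.
split; last by move=> s sv ss; split; exact: time_integral_Cs.
have t0 := time_set_ge0 kt.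
have bC := @bounded_borel_cracks_until R k Oext tstar bO.
have intensityE Om : shapes Om ->
    crack_intensity k rho_vol rho_sur Om (u Om) (cracks_until k Oext tstar) = J Om (u Om).
  by move=> sO; have [[oO _ _ _ _] cO] := Olip _ sO;
    apply: crack_intensity_until => //; exact: ureg.
have J_fin Om : shapes Om -> J Om (u Om) \is a fin_num.
  move=> sO; rewrite ge0_fin_numE -intensityE//; first exact: radon.
  apply: adde_ge0; apply: integral_ge0 => z [_ [/= kz _]]; rewrite lee_fin.
    by case: rhov => _; apply.
  by case: rhos => _; apply.
have probE Om : shapes Om ->
    P [set w | (T Om w <= tstar%:E)%E] = (1 - expR (- fine (J Om (u Om))))%:E.
  by move=> sO; rewrite (prob_crack_until bO t0 (pois _ sO)) intensityE.
move=> Os sOs.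
(* For a finite [J], the failure probability is a strictly increasing function
   of [J]. *)
suff cmp Om : shapes Om ->
    (P [set w | (T Os w <= tstar%:E)%E] <= P [set w | (T Om w <= tstar%:E)%E])%E =
    (J Os (u Os) <= J Om (u Om))%E.
  by split=> opt Om sO; move: (opt Om sO); rewrite cmp.
move=> sO; rewrite (probE _ sOs) (probE _ sO) lee_fin lerD2l lerN2 ler_expR lerN2.
have := J_fin _ sO; have := J_fin _ sOs.
move: (J Os (u Os)) (J Om (u Om)) => a b fa fb.
by rewrite -lee_fin (fineK fa) (fineK fb).
Qed.
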